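(* Let $q \ge 2$, let $r \ge 1$, and let $(\Omega,\mu)$ be a finite probability space. Let $f\colon (\Omega^n,\mu^n)\to\mathbb{R}$ satisfy $\|f_{S\to x}\|_2 \le r^{|S|}\|f\|_2$ for all $S\subseteq[n]$ and all $x\in\Omega^S$. If $0<\rho \le \frac{\log q}{32 r q}$, then $\|T_\rho f\|_q \le \|f\|_2$.
   Context: $\log$ denotes the natural logarithm. All norms are with respect to the product measure $\mu^n$ (or its projection on the relevant coordinates). For $S\subseteq[n]$ and $x\in\Omega^S$, the restriction $f_{S\to x}\colon\Omega^{[n]\setminus S}\to\mathbb{R}$ is $f_{S\to x}(y)=f(x,y)$. The noise operator $T_\rho$ is $T_\rho f(x)=\mathbb{E}_{y}[f(y)]$, where $y$ is obtained from $x$ by keeping each coordinate $x_i$ independently with probability $\rho$ and replacing it by an independent sample of $\mu$ with probability $1-\rho$. *)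

(* Defs.v *)
From HB Require Import structures.
From mathcomp Require Import all_boot all_order all_algebra.
From mathcomp Require Import all_classical all_reals all_analysis.
Set Implicit Arguments. Unset Strict Implicit. Unset Printing Implicit Defensive.
Import Order.TTheory GRing.Theory Num.Theory.
Local Open Scope ring_scope.

Section Defs.
Variables (R : realType) (Omega : finType) (mu : Omega -> R) (n : nat).

Definition is_prob_space : Prop :=
  (forall w, 0 <= mu w) /\ \sum_(w : Omega) mu w = 1.

Definition pt := {ffun 'I_n -> Omega}.

Definition mu_n (x : pt) : R := \prod_(i < n) mu (x i).

Definition lpnorm (p : R) (g : pt -> R) : R :=
  (\sum_(x : pt) mu_n x * powR `|g x| p) `^ p^-1.

(* L^p norm of the restriction f_{S -> x} : Omega^{[n]\S} -> R, w.r.t. the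
   product measure on the coordinates outside S.  A point y of Omega^{[n]\S}
   is represented by the unique full point agreeing with x on S and with y
   off S; only the values of x on S matter. *)
Definition restr_lpnorm (p : R) (S : {set 'I_n}) (x : pt) (f : pt -> R) : R :=
  (\sum_(y : pt | [forall i in S, y i == x i])
      (\prod_(i in ~: S) mu (y i)) * powR `|f y| p) `^ p^-1.

(* one-coordinate noise kernel: keep with prob. rho, resample with prob 1-rho *)
Definition noise_kernel (rho : R) (a b : Omega) : R :=
  rho * (a == b)%:R + (1 - rho) * mu b.

Definition T_rho (rho : R) (f : pt -> R) (x : pt) : R :=
  \sum_(y : pt) (\prod_(i < n) noise_kernel rho (x i) (y i)) * f y.

End Defs.

(* Main.v *)
(** The coordinates are treated one at a time.  Let [E_i] average over coordinate [i], let
    [p = q / 2], [c = 1 / (2 r)] and [a = E_i h].  A one-coordinate inequality, in which the norm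
    over the coordinates already treated acts as a Hilbert norm, bounds the mixed [2p]-moment of
    [a + rho (h - a)] by that of [a + (h - a) / 2], where coordinate [i] is moved to the inner [L^2]
    norm, plus that of [c (h - a)], where it stays in the outer [L^q] norm.  Both functions satisfy
    again the globalness hypothesis in the remaining coordinates with the same bound
    [M = ||f||_2^2], the second one because [c^2 (2 r^2 + 2) <= 1], and the sum of their squared
    [L^2] norms is at most that of [h], because [1/4 + c^2 <= 1].  Once no coordinate is left,
    globalness gives [(E_V h^2)^p <= M^(p-1) E_V h^2] pointwise, and the squared [L^2] norms add up
    to at most [M]. *)

Require Import Defs.
From mathcomp Require Import all_boot all_order all_algebra.
From mathcomp Require Import all_classical all_reals all_analysis.
From mathcomp Require Import ring lra finset.
Set Implicit Arguments. Unset Strict Implicit. Unset Printing Implicit Defensive.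
Import Order.TTheory GRing.Theory Num.Theory.
Local Open Scope ring_scope.

(** * Scalar inequalities for exponentials and real powers *)

Lemma expR_sub1_le_sqr (R : realType) (s m : R) : `|s| <= m ->
  expR s <= 1 + s + s ^+ 2 * expR m.
Proof.
move=> sm.
have s_le_m : s <= m := le_trans (ler_norm _) sm.
have e0 := expR_gt0 s.
have e1 : expR s - 1 <= s * expR s.
  have := expR_ge1Dx (- s); rewrite expRN -(ler_pM2l e0) mulfV ?gt_eqF //; lra.
have em : expR s <= expR m by rewrite ler_expR.
have m1 : 1 <= expR m by rewrite -expR0 ler_expR (le_trans _ sm).
have s2 : 0 <= s ^+ 2 by rewrite sqr_ge0.
have [s0|s0] := leP 0 s.
  have := ler_wpM2l s0 e1; have := ler_wpM2l s2 em; rewrite expr2; nra.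
have := expR_ge1Dx s; nra.
Qed.

(** Convexity of the [p]-th power, obtained from Young's inequality for [x] and [y^(p-1)] with
    exponents [p] and [p / (p - 1)]. The case [p = 1], where the conjugate exponent is infinite, is
    treated apart. *)
Lemma powR_tangent (R : realType) (p x y : R) : 1 <= p -> 0 <= x -> 0 <= y ->
  p * (x * powR y (p - 1)) <= powR x p + (p - 1) * powR y p.
Proof.
rewrite le_eqVlt => /predU1P[<-|p1] x0 y0.
  by rewrite subrr powRr0 mul0r addr0 mul1r mulr1 powRr1.
have p0 : 0 < p by lra.
have pB0 : 0 < p - 1 by lra.
have pp : (p - 1) * (p / (p - 1)) = p by field; lra.
have q0 : 0 < p / (p - 1) by rewrite divr_gt0.
have pq : p^-1 + (p / (p - 1))^-1 = 1 by field; lra.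
have := conjugate_powR x0 (powR_ge0 y (p - 1)) p0 q0 pq.
rewrite -powRrM pp => H.
apply: le_trans (ler_wpM2l (ltW p0) H) _.
by rewrite le_eqVlt; apply/orP; left; apply/eqP; field; lra.
Qed.

Lemma powR_tangentD (R : realType) (p x y : R) : 1 <= p -> 0 <= x -> 0 <= y ->
  powR x p + p * powR x (p - 1) * y <= powR (x + y) p.
Proof.
move=> p1 x0 y0.
have := @powR_tangent R p (x + y) x p1 (addr_ge0 x0 y0) x0.
rewrite mulrDl mulr_powRB1 //; lra.
Qed.

Lemma powR_le_expR (R : realType) (p x : R) : 0 <= p -> 0 <= 1 + x ->
  powR (1 + x) p <= expR (p * x).
Proof.
move=> p0 x0; rewrite mulrC expRM.
by apply: ge0_ler_powR => //; rewrite ?nnegrE ?expR_ge0 // expR_ge1Dx.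
Qed.

(** The one-coordinate inequality with the base normalised to 1: [b] plays an inner product with a
    unit vector and [g] a squared norm. The linear term in [b] is kept exactly, since it later
    averages to zero; all other contributions are absorbed by [p g] or [g^p]. *)
Lemma powR_perturb1_le (R : realType) (p e b g : R) :
  1 <= p -> 0 <= e -> e <= ln (2 * p) / (32 * p) -> b ^+ 2 <= g ->
  0 <= 1 + 2 * e * b + e ^+ 2 * g ->
  powR (1 + 2 * e * b + e ^+ 2 * g) p <= 1 + p * (2 * e * b + g) + powR g p.
Proof.
move=> p1 e0 eb bg d0.
have p0 : 0 < p by lra.
have g0 : 0 <= g by apply: le_trans bg; rewrite sqr_ge0.
(* With this [l], [expR l] is the fourth root of [2 p]. The hypothesis on [e] reads [p e <= l / 8],
   and [l <= expR l] yields [l^2 expR l <= 2 p], which pays for the Taylor remainder. *)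
set l := ln (2 * p) / 4.
have l0 : 0 <= l by rewrite divr_ge0 // ln_ge0; lra.
have El : expR l ^+ 4 = 2 * p.
  rewrite -expRM_natl /l -[4%:R]/4 mulrC divfK ?pnatr_eq0 // lnK // posrE; lra.
have l1 : 1 + l <= expR l := expR_ge1Dx l.
have pe : p * e <= l / 8.
  have : p * e <= p * (ln (2 * p) / (32 * p)) by rewrite ler_pM2l.
  suff -> : p * (ln (2 * p) / (32 * p)) = l / 8 by [].
  by rewrite /l; field; lra.
set E := expR l in El l1.
have E1 : 1 <= E by lra.
have lE : l <= E by lra.
have E2 : E <= E ^+ 2 by rewrite expr2; nra.
have E24 : E ^+ 2 <= E ^+ 4 by rewrite -[4%N]/(2 * 2)%N exprM [leRHS]expr2; nra.
have e16 : e <= 1 / 16.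
  have : p * e <= p / 4 by lra.
  nra.
(* For [g >= 4] the term [g ^ p] alone suffices; below, it is the quadratic Taylor term that does. *)
have [g4|g4] := leP 4 g.
  have bb : `|b| <= g / 2.
    rewrite -(@ler_pXn2r _ 2) ?nnegrE ?divr_ge0 // -normrX ger0_norm ?sqr_ge0 //.
    rewrite expr2 in bg; nra.
  have /andP[b1 b2] : - (g / 2) <= b <= g / 2 by rewrite -ler_norml.
  have eg : e * g <= g / 16 by have := ler_wpM2r g0 e16; lra.
  have eb2 := ler_wpM2l e0 b2.
  have eb1 := ler_wpM2l e0 b1.
  have dg : 1 + 2 * e * b + e ^+ 2 * g <= g.
    have : e ^+ 2 * g <= g / 16 by have := ler_wpM2l e0 eg; rewrite expr2; lra.
    lra.
  have : powR (1 + 2 * e * b + e ^+ 2 * g) p <= powR g p.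
    by apply: ge0_ler_powR => //; rewrite ?nnegrE // ltW.
  have : 0 <= p * (2 * e * b + g) by apply: mulr_ge0; lra.
  lra.
have bb : `|b| <= 2.
  rewrite -(@ler_pXn2r _ 2) ?nnegrE // -normrX ger0_norm ?sqr_ge0 //; lra.
have /andP[b1 b2] : - 2 <= b <= 2 by rewrite -ler_norml.
set x := 2 * e * b + e ^+ 2 * g.
have ex : e ^+ 2 * g <= e / 4 by rewrite expr2; nra.
have ex0 : 0 <= e ^+ 2 * g by rewrite mulr_ge0 ?sqr_ge0.
have sl : `|p * x| <= l.
  have xe : `|x| <= 5 * e by rewrite ler_norml /x; apply/andP; split; nra.
  rewrite normrM gtr0_norm //; nra.
have := @powR_le_expR R p x (ltW p0); rewrite /x addrA => /(_ d0) H.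
apply: le_trans H _; rewrite -/x.
have := @expR_sub1_le_sqr R (p * x) l sl; rewrite -/E => H.
apply: le_trans H _.
have := powR_ge0 g p => gp.
(* The linear term [2 p e b] cancels, leaving only second-order terms. They are bounded by [p g / 2]
   and [9/32 p g]. *)
suff : p * (e ^+ 2 * g) + (p * x) ^+ 2 * E <= p * g by rewrite /x; lra.
have px2 : (p * x) ^+ 2 <= 9 * (p * e) ^+ 2 * g.
  have -> : 9 * (p * e) ^+ 2 * g = p ^+ 2 * (9 * e ^+ 2 * g) by ring.
  rewrite exprMn ler_pM2l ?exprn_gt0 //.
  have : x ^+ 2 <= 2 * (2 * e * b) ^+ 2 + 2 * (e ^+ 2 * g) ^+ 2.
    by rewrite /x; have := sqr_ge0 (2 * e * b - e ^+ 2 * g); lra.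
  have : (2 * e * b) ^+ 2 <= 4 * (e ^+ 2 * g).
    have -> : (2 * e * b) ^+ 2 = 4 * e ^+ 2 * b ^+ 2 by ring.
    by have := ler_wpM2l (sqr_ge0 e) bg; lra.
  have : (e ^+ 2 * g) ^+ 2 <= e ^+ 2 * g / 4 by rewrite [leLHS]expr2; nra.
  lra.
have pe2 : (p * e) ^+ 2 <= l ^+ 2 / 64.
  have -> : l ^+ 2 / 64 = (l / 8) ^+ 2 by field.
  have pe0 : 0 <= p * e by rewrite mulr_ge0 // ltW.
  rewrite ler_pXn2r // nnegrE; lra.
have l2E : l ^+ 2 * E <= 2 * p.
  have -> : 2 * p = E ^+ 2 * E ^+ 2 by rewrite -El; ring.
  have lE2 : l ^+ 2 <= E ^+ 2 by rewrite ler_pXn2r ?nnegrE //; lra.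
  by apply: ler_pM => //; [rewrite sqr_ge0 | lra].
have S1 : (p * x) ^+ 2 * E <= 9 * (l ^+ 2 / 64) * g * E.
  rewrite ler_wpM2r ?(le_trans ler01 E1) //; apply: le_trans px2 _.
  by rewrite ler_wpM2r // ler_pM2l.
have S2 : 9 * (l ^+ 2 / 64) * g * E <= 9 / 32 * p * g.
  have -> : 9 * (l ^+ 2 / 64) * g * E = 9 / 64 * g * (l ^+ 2 * E) by field.
  have -> : 9 / 32 * p * g = 9 / 64 * g * (2 * p) by field.
  by rewrite ler_wpM2l // mulr_ge0.
have S3 : p * (e ^+ 2 * g) <= p * g / 2.
  have e2 : e ^+ 2 <= 1 / 2 by rewrite expr2; nra.
  by have := ler_wpM2l (ltW p0) (ler_wpM2r g0 e2); lra.
have : 0 <= p * g by rewrite mulr_ge0 // ltW.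
lra.
Qed.

(** Homogeneity: for [a > 0], divide by [a] and use the normalised case. For [a = 0] the
    Cauchy-Schwarz hypothesis forces [b = 0], and [e <= 1] is enough. *)
Lemma powR_perturb_le (R : realType) (p e a b g : R) :
  1 <= p -> 0 <= e -> e <= ln (2 * p) / (32 * p) ->
  0 <= a -> b ^+ 2 <= a * g -> 0 <= g ->
  0 <= a + 2 * e * b + e ^+ 2 * g ->
  powR (a + 2 * e * b + e ^+ 2 * g) p <=
    powR a p + p * powR a (p - 1) * (2 * e * b + g) + powR g p.
Proof.
move=> p1 e0 eb; rewrite le_eqVlt => /predU1P[<-|a0] bg g0 d0.
  have b0 : b = 0.
    by apply/eqP; rewrite -sqrf_eq0 eq_le sqr_ge0 andbT -(mul0r g).
  have e1 : e <= 1.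
    apply: (le_trans eb); rewrite ler_pdivrMr; last lra.
    have := @le_ln1Dx R (2 * p - 1); have -> : 1 + (2 * p - 1) = 2 * p by ring.
    move=> H; have {}H : ln (2 * p) <= 2 * p - 1 by apply: H; lra.
    lra.
  rewrite b0 mulr0 !add0r powR0 ?add0r; last lra.
  have : powR (e ^+ 2 * g) p <= powR g p.
    apply: ge0_ler_powR; rewrite ?nnegrE ?mulr_ge0 ?sqr_ge0 //; first lra.
    by rewrite ler_piMl // expr_le1.
  (* For [p = 1] the factor [powR 0 (p - 1)] is 1, not 0, so only its sign is used. *)
  have : 0 <= p * powR 0 (p - 1) * g by rewrite !mulr_ge0 ?powR_ge0 //; lra.
  lra.
have := @powR_perturb1_le R p e (b / a) (g / a) p1 e0 eb.
have -> : 1 + 2 * e * (b / a) + e ^+ 2 * (g / a) = (a + 2 * e * b + e ^+ 2 * g) / a.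
  by field; lra.
rewrite divr_ge0 ?(ltW a0) // => H.
have {}H := H _ isT.
have : (b / a) ^+ 2 <= g / a.
  rewrite expr_div_n ler_pdivrMr ?exprn_gt0 //.
  by have -> : g / a * a ^+ 2 = a * g by field; lra.
move=> /H {}H.
have ap : 0 <= powR a p by rewrite powR_ge0.
have := ler_wpM2l ap H; rewrite -powRM ?divr_ge0 ?(ltW a0) //.
rewrite [_ * (_ / _)]mulrC divfK ?gt_eqF // => {}H; apply: (le_trans H).
rewrite mulrDr -powRM ?divr_ge0 ?(ltW a0) //.
rewrite [a * (_ / _)]mulrC divfK ?gt_eqF // lerD2r.
rewrite mulrDr mulr1 lerD2l -(@mulr_powRB1 _ a p) ?(ltW a0) //; last lra.
by rewrite le_eqVlt; apply/orP; left; apply/eqP; field; lra.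
Qed.

(** * Operators with a product kernel *)

Section TensorOperators.
Variables (R : realType) (Omega : finType) (n : nat).
Implicit Types (f g : pt Omega n -> R) (K : 'I_n -> Omega -> Omega -> R).

(** Identity, partial averages and noise are all of this form, so identities between them reduce to
    identities of one-coordinate kernels. *)
Definition tens K f (x : pt Omega n) : R :=
  \sum_(y : pt Omega n) (\prod_(i < n) K i (x i) (y i)) * f y.

Lemma eq_tens K K' f : (forall i a b, K i a b = K' i a b) -> tens K f = tens K' f.
Proof.
by move=> H; apply/funext => x; apply: eq_bigr => y _; congr (_ * _); apply: eq_bigr.
Qed.

Lemma tens_comp K K' f :
  tens K (tens K' f) = tens (fun i a b => \sum_c K i a c * K' i c b) f.
Proof.
apply/funext => x; rewrite /tens.
under eq_bigr do rewrite mulr_sumr.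
rewrite exchange_big; apply: eq_bigr => z _ /=.
under eq_bigr do rewrite mulrA.
rewrite -mulr_suml bigA_distr_bigA; congr (_ * _).
by apply: eq_bigr => y _; rewrite -big_split.
Qed.

Lemma tensD K f g x : tens K (fun y => f y + g y) x = tens K f x + tens K g x.
Proof. by rewrite -big_split; apply: eq_bigr => y _; rewrite mulrDr. Qed.

Lemma tensZ K c f x : tens K (fun y => c * f y) x = c * tens K f x.
Proof. by rewrite mulr_sumr; apply: eq_bigr => y _; rewrite mulrCA. Qed.

Lemma tens_id f : tens (fun _ a b => (a == b)%:R) f = f.
Proof.
apply/funext => x; rewrite /tens (bigD1 x) //= big1 => [|i _]; last by rewrite eqxx.
rewrite mul1r big1 ?addr0 // => y yx.
have /existsP[i xy] : [exists i, x i != y i].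
  by apply: contraR yx => /existsPn H; apply/eqP/ffunP => i; apply/esym/eqP/negPn/H.
by rewrite (bigD1 i) //= (negPf xy) !mul0r.
Qed.

(** The product kernel is linear in its [i]-th factor; this is how the noise on a single coordinate
    is split off. *)
Lemma tens_multilinear K K1 K2 i s t f x :
  (forall a b, K i a b = s * K1 i a b + t * K2 i a b) ->
  (forall j a b, j != i -> K j a b = K1 j a b) ->
  (forall j a b, j != i -> K j a b = K2 j a b) ->
  tens K f x = s * tens K1 f x + t * tens K2 f x.
Proof.
move=> Ki K1j K2j; rewrite !mulr_sumr -big_split; apply: eq_bigr => y _ /=.
rewrite (bigD1 i) //= Ki [\prod_(k < n) K1 _ _ _](bigD1 i) //=.
rewrite [\prod_(k < n) K2 _ _ _](bigD1 i) //=.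
rewrite -(eq_bigr _ (fun j ji => K1j j (x j) (y j) ji)).
rewrite -(eq_bigr _ (fun j ji => K2j j (x j) (y j) ji)).
by ring.
Qed.

Lemma ler_tens K f g x : (forall i a b, 0 <= K i a b) ->
  (forall y, f y <= g y) -> tens K f x <= tens K g x.
Proof.
by move=> K0 fg; apply: ler_sum => y _; rewrite ler_wpM2l // prodr_ge0.
Qed.

End TensorOperators.

(** * Partial averages and partial noise *)

Section PartialAverages.
Variables (R : realType) (Omega : finType) (n : nat) (mu : Omega -> R).
Hypothesis mu_prob : is_prob_space mu.
Implicit Types (f g h : pt Omega n -> R) (U V W T : {set 'I_n}) (i : 'I_n).

Let mu0 w : 0 <= mu w. Proof. exact: (proj1 mu_prob). Qed.
Let mu1 : \sum_w mu w = 1. Proof. exact: (proj2 mu_prob). Qed.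

(** Coordinates in [V] are resampled and the others kept, so a partial average remains a function on
    the full product space. *)
Definition avg_kernel V (i : 'I_n) (a b : Omega) : R :=
  if i \in V then mu b else (a == b)%:R.

Definition avg V := tens (avg_kernel V).

Definition noise_on (rho : R) U :=
  tens (fun i a b => if i \in U then noise_kernel mu rho a b else (a == b)%:R).

Definition mean f : R := \sum_(x : pt Omega n) mu_n mu x * f x.

Definition indep i g := forall x y : pt Omega n, (forall j, j != i -> x j = y j) -> g x = g y.

Lemma sum_deltal (a : Omega) (F : Omega -> R) : \sum_c (a == c)%:R * F c = F a.
Proof.
rewrite (bigD1 a) //= eqxx mul1r big1 ?addr0 // => c /negPf.
by rewrite eq_sym => ->; rewrite mul0r.
Qed.

Lemma sum_deltar (a : Omega) (F : Omega -> R) : \sum_c F c * (c == a)%:R = F a.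
Proof.
rewrite (bigD1 a) //= eqxx mulr1 big1 ?addr0 // => c /negPf ->.
by rewrite mulr0.
Qed.

(** Checked on one coordinate: resampling twice is resampling once. Commutation and idempotence of
    the averages both follow from this. *)
Lemma avg_comp V W f : avg V (avg W f) = avg (V :|: W) f.
Proof.
rewrite /avg tens_comp; apply: eq_tens => i a b; rewrite /avg_kernel in_setU.
case: (i \in V); case: (i \in W) => /=; first by rewrite -mulr_suml mu1 mul1r.
- by rewrite sum_deltar.
- by rewrite sum_deltal.
- by rewrite sum_deltal.
Qed.

Lemma avg0 f : avg set0 f = f.
Proof.
by rewrite -[RHS](@tens_id R Omega n); apply: eq_tens => i a b; rewrite /avg_kernel in_set0.
Qed.

Lemma avg_kernel_ge0 V i a b : 0 <= avg_kernel V i a b.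
Proof. by rewrite /avg_kernel; case: ifP => //; rewrite ler0n. Qed.

Lemma ler_avg V f g x : (forall y, f y <= g y) -> avg V f x <= avg V g x.
Proof. by apply: ler_tens => *; exact: avg_kernel_ge0. Qed.

Lemma avg_ge0 V f x : (forall y, 0 <= f y) -> 0 <= avg V f x.
Proof.
by move=> f0; apply: sumr_ge0 => y _; rewrite mulr_ge0 // prodr_ge0 // => i _; exact: avg_kernel_ge0.
Qed.

Lemma avg_cst V c x : avg V (fun=> c) x = c.
Proof.
rewrite /avg /tens -mulr_suml.
have -> : \sum_(y : pt Omega n) \prod_(i < n) avg_kernel V i (x i) (y i) =
    \prod_(i < n) \sum_b avg_kernel V i (x i) b by rewrite bigA_distr_bigA.
rewrite big1 ?mul1r // => i _.
rewrite /avg_kernel; case: (i \in V) => //.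
by rewrite -[RHS](sum_deltal (x i) (fun=> 1)); apply: eq_bigr => b _; rewrite mulr1.
Qed.

Lemma indep_avg1 i f : indep i (avg [set i] f).
Proof.
move=> x y xy; apply: eq_bigr => z _; congr (_ * _); apply: eq_bigr => j _.
by rewrite /avg_kernel in_set1; case: eqP => // /eqP /xy ->.
Qed.

Lemma avg1_pull i f g x : indep i g ->
  avg [set i] (fun y => g y * f y) x = g x * avg [set i] f x.
Proof.
move=> gi; rewrite mulr_sumr; apply: eq_bigr => y _.
(* Points [y] that differ from [x] off [i] have zero weight; on the remaining ones [g y = g x]. *)
have [xy|] := boolP [forall j, (j != i) ==> (x j == y j)]; last first.
  rewrite negb_forall => /existsP[j]; rewrite negb_imply => /andP[ji xy].
  have P0 : \prod_(k < n) avg_kernel [set i] k (x k) (y k) = 0.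
    by rewrite (bigD1 j) //= {1}/avg_kernel in_set1 (negPf ji) (negPf xy) mul0r.
  by rewrite P0 !mul0r mulr0.
by rewrite mulrCA (gi x y) // => j ji; apply/eqP/(implyP (forallP xy j)).
Qed.

Lemma avg1_indep i g : indep i g -> avg [set i] g = g.
Proof.
move=> gi; apply/funext => x; rewrite -[RHS]mulr1 -(avg_cst [set i] 1 x) -avg1_pull //.
by congr (avg _ _ _); apply/funext => y; rewrite mulr1.
Qed.

Lemma indep_avg i V g : indep i g -> indep i (avg V g).
Proof.
by move=> gi; rewrite -(@avg1_indep i g gi) avg_comp setUC -avg_comp; exact: indep_avg1.
Qed.

Lemma avg_setT f x : avg setT f x = mean f.
Proof.
apply: eq_bigr => y _; congr (_ * _); apply: eq_bigr => i _.
by rewrite /avg_kernel in_setT.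
Qed.

Lemma mean_avg V f : mean (avg V f) = mean f.
Proof.
(* The mean is the average over all coordinates evaluated at any point; if there is no point, both
   sums are empty. *)
have [x|x0] := pickP (pt Omega n); first by rewrite -!(avg_setT _ x) avg_comp setTU.
by rewrite /mean !big_pred0.
Qed.

Lemma ler_mean f g : (forall x, f x <= g x) -> mean f <= mean g.
Proof. by move=> fg; apply: ler_sum => x _; rewrite ler_wpM2l // prodr_ge0. Qed.

Lemma meanD f g : mean (fun x => f x + g x) = mean f + mean g.
Proof. by rewrite -big_split; apply: eq_bigr => x _; rewrite mulrDr. Qed.

Lemma meanZ c f : mean (fun x => c * f x) = c * mean f.
Proof. by rewrite mulr_sumr; apply: eq_bigr => x _; rewrite mulrCA. Qed.

Lemma avg_cauchy_schwarz V f g x :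
  avg V (fun y => f y * g y) x ^+ 2 <= avg V (fun y => f y ^+ 2) x * avg V (fun y => g y ^+ 2) x.
Proof.
set A := avg V (fun y => f y ^+ 2) x; set B := avg V _ x; set C := avg V (fun y => g y ^+ 2) x.
have H s t : 0 <= s ^+ 2 * A + (2 * s * t * B + t ^+ 2 * C).
  rewrite /A /B /C /avg -!tensZ -!tensD.
  apply: avg_ge0 => y.
  have -> : s ^+ 2 * f y ^+ 2 + (2 * s * t * (f y * g y) + t ^+ 2 * g y ^+ 2)
      = (s * f y + t * g y) ^+ 2 by ring.
  exact: sqr_ge0.
have A0 : 0 <= A by apply: avg_ge0 => y; exact: sqr_ge0.
have C0 : 0 <= C by apply: avg_ge0 => y; exact: sqr_ge0.
clearbody A B C; move: A0; rewrite le_eqVlt => /predU1P[A0|A0].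
  have := mulr_ge0 C0 (sqr_ge0 B); have := sqr_ge0 B.
  (* For [A = 0] this choice gives [0 <= - (C + 2) B^2], hence [B = 0]. For [A > 0], the choice [B],
     [- A] gives [0 <= A (A C - B^2)]. *)
  have := H (- (C + 1)) B; rewrite -A0; lra.
by have {}H := H B (- A); rewrite -(ler_pM2l A0); lra.
Qed.

(** Pythagoras: [h - E_i h] is orthogonal to functions independent of [i], so the cross term
    vanishes and [t^2] multiplies the conditional variance. *)
Lemma avg1_sqr_dev i h t x :
  avg [set i] (fun y => (avg [set i] h y + t * (h y - avg [set i] h y)) ^+ 2) x =
  avg [set i] h x ^+ 2 +
  t ^+ 2 * (avg [set i] (fun y => h y ^+ 2) x - avg [set i] h x ^+ 2).
Proof.
set a := avg [set i] h.
have ai : indep i a by exact: indep_avg1.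
have -> : (fun y => (a y + t * (h y - a y)) ^+ 2) =
    (fun y => (1 - t) ^+ 2 * (a y * a y) + (2 * t * (1 - t) * (a y * h y) + t ^+ 2 * h y ^+ 2)).
  by apply/funext => y; ring.
have aa : avg [set i] (fun y => a y * a y) x = a x * a x.
  by rewrite avg1_pull //; congr (_ * _); exact: (congr1 (@^~ x) (avg1_indep ai)).
have ah : avg [set i] (fun y => a y * h y) x = a x * a x by rewrite avg1_pull.
by rewrite {1}/avg !tensD !tensZ -/(avg _) aa ah; ring.
Qed.

Lemma avg1_sqr_le i h x : avg [set i] h x ^+ 2 <= avg [set i] (fun y => h y ^+ 2) x.
Proof.
have := avg_cauchy_schwarz [set i] h (fun=> 1) x.
rewrite expr1n avg_cst mulr1.
by have -> : (fun y => h y * 1) = h by apply/funext => y; rewrite mulr1.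
Qed.

Lemma avg1_dev_sqr i h c x :
  avg [set i] (fun y => (c * (h y - avg [set i] h y)) ^+ 2) x =
  c ^+ 2 * (avg [set i] (fun y => h y ^+ 2) x - avg [set i] h x ^+ 2).
Proof.
set a := avg [set i] h.
have ai : indep i a by exact: indep_avg1.
have -> : (fun y => (c * (h y - a y)) ^+ 2) =
    (fun y => c ^+ 2 * (a y * a y) + ((- (2 * c ^+ 2)) * (a y * h y) + c ^+ 2 * h y ^+ 2)).
  by apply/funext => y; ring.
have aa : avg [set i] (fun y => a y * a y) x = a x * a x.
  by rewrite avg1_pull //; congr (_ * _); exact: (congr1 (@^~ x) (avg1_indep ai)).
have ah : avg [set i] (fun y => a y * h y) x = a x * a x by rewrite avg1_pull.
by rewrite {1}/avg !tensD !tensZ -/(avg _) aa ah; ring.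
Qed.

Lemma noise_on_set0 rho f : noise_on rho set0 f = f.
Proof. by rewrite -[RHS](@tens_id R Omega n); apply: eq_tens => i a b; rewrite in_set0. Qed.

Lemma noise_on_setT rho f : noise_on rho setT f = T_rho mu rho f.
Proof.
apply/funext => x; apply: eq_bigr => y _; congr (_ * _).
by apply: eq_bigr => i _; rewrite in_setT.
Qed.

Lemma noise_on_avg1 rho U i f : i \notin U ->
  noise_on rho U (avg [set i] f) = avg [set i] (noise_on rho U f).
Proof.
move=> iU; rewrite /noise_on /avg !tens_comp; apply: eq_tens => j a b.
rewrite /avg_kernel in_set1; have [->|_] := eqVneq j i.
  by rewrite (negPf iU) sum_deltal sum_deltar.
by rewrite sum_deltal sum_deltar.
Qed.

(** On coordinate [i] the noise kernel is [rho] times the identity plus [1 - rho] times the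
    average. *)
Lemma noise_on_setU1 rho U i f x : i \notin U ->
  noise_on rho (i |: U) f x =
  rho * noise_on rho U f x + (1 - rho) * avg [set i] (noise_on rho U f) x.
Proof.
move=> iU; rewrite /avg {2}/noise_on tens_comp.
apply: (@tens_multilinear _ _ _ _ _ _ i) => [a b|j a b ji|j a b ji].
- by rewrite setU11 (negPf iU) /avg_kernel set11 sum_deltar.
- by rewrite in_setU1 (negPf ji).
- by rewrite in_setU1 /avg_kernel in_set1 (negPf ji) /= sum_deltal.
Qed.

End PartialAverages.

(** * The one-coordinate step and the induction over coordinates *)

Section GlobalHypercontractivity.
Variables (R : realType) (Omega : finType) (n : nat) (mu : Omega -> R).
Hypothesis mu_prob : is_prob_space mu.
Implicit Types (f g h : pt Omega n -> R) (U V W T : {set 'I_n}) (i : 'I_n).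

(* The [2p]-th power of the norm that is [L^2] in the coordinates of [V] and [L^(2p)] in the others. *)
Definition mixed_moment (p : R) V g : R :=
  mean mu (fun x => powR (avg mu V (fun y => g y ^+ 2) x) p).

(** With [u = c (h - a)], the inner norm of [a + e u] expands as [al + 2 e be + e^2 ga], to which
    [powR_perturb_le] applies by Cauchy-Schwarz. Averaging over [i] kills [be] because [E_i u = 0],
    and [al] does not depend on [i]. The tangent bound then gathers the first two terms into
    [(al + E_i ga)^p], while [ga^p] gives the last moment. *)
Lemma mixed_moment_step p e c V i h : 1 <= p -> 0 <= e ->
  e <= ln (2 * p) / (32 * p) -> 0 <= c -> c <= 1 / 2 ->
  mixed_moment p V (fun x => avg mu [set i] h x + e * c * (h x - avg mu [set i] h x)) <=
  mixed_moment p (i |: V)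
    (fun x => avg mu [set i] h x + 1 / 2 * (h x - avg mu [set i] h x)) +
  mixed_moment p V (fun x => c * (h x - avg mu [set i] h x)).
Proof.
move=> p1 e0 eb c0 c2.
set a := avg mu [set i] h; set u := fun x => c * (h x - a x).
have p0 : 0 <= p by lra.
have ai : indep i a by exact: indep_avg1.
pose al := avg mu V (fun y => a y ^+ 2).
pose be := avg mu V (fun y => a y * u y).
pose ga := avg mu V (fun y => u y ^+ 2).
have ali : indep i al by apply: indep_avg => // x y xy; rewrite (ai x y xy).
have al0 x : 0 <= al x by apply: avg_ge0 => // y; exact: sqr_ge0.
have ga0 x : 0 <= ga x by apply: avg_ge0 => // y; exact: sqr_ge0.
have u0 : avg mu [set i] u = fun=> 0.
  apply/funext => x; rewrite /u.
  have -> : (fun y => c * (h y - a y)) = (fun y => c * h y + (- c) * a y).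
    by apply/funext => y; ring.
  by rewrite {1}/avg tensD !tensZ -/(avg _ _) (avg1_indep _ ai) // -/a; ring.
have be0 x : avg mu [set i] be x = 0.
  rewrite /be avg_comp // setUC -avg_comp //.
  have -> : avg mu [set i] (fun y => a y * u y) = fun=> 0.
    by apply/funext => y; rewrite avg1_pull // u0 mulr0.
  by rewrite avg_cst.
pose de := avg mu V (fun y => (a y + e * c * (h y - a y)) ^+ 2).
have deE x : de x = al x + 2 * e * be x + e ^+ 2 * ga x.
  rewrite /de /al /be /ga.
  have -> : (fun y => (a y + e * c * (h y - a y)) ^+ 2) =
     (fun y => a y ^+ 2 + (2 * e * (a y * u y) + e ^+ 2 * u y ^+ 2)).
    by apply/funext => y; rewrite /u; ring.
  by rewrite {1}/avg !tensD !tensZ addrA.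
have de0 x : 0 <= de x by apply: avg_ge0 => // y; exact: sqr_ge0.
rewrite /mixed_moment -/de -/ga -meanD -(mean_avg mu_prob [set i]).
rewrite -(mean_avg mu_prob [set i] (fun x => powR _ p + _)).
apply: ler_mean => // x.
set b2 := avg mu (i |: V) _.
have b2i : indep i (fun x => powR (b2 x) p).
  move=> y z yz; congr (powR _ _); rewrite /b2 -avg_comp //.
  exact: (indep_avg1 _ _ yz).
(* Both sides are [E_V a^2] plus a multiple of the averaged variance; the multiples compare as
   [c^2 <= 1/4]. *)
have b2E y : al y + avg mu [set i] ga y <= b2 y.
  rewrite /b2 setUC -avg_comp // /ga avg_comp // setUC -avg_comp // /al.
  rewrite {1 2}/avg -tensD; apply: ler_avg => // z.
  rewrite avg1_sqr_dev // avg1_dev_sqr // lerD2l ler_wpM2r ?subr_ge0 ?avg1_sqr_le //.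
  by rewrite ler_pXn2r ?nnegrE //; lra.
apply: (@le_trans _ _ (avg mu [set i] (fun y =>
    powR (al y) p + (p * powR (al y) (p - 1) * (2 * e * be y + ga y) + powR (ga y) p)) x)).
  apply: ler_avg => // y; rewrite -/(de y) deE addrA.
  apply: powR_perturb_le => //; first exact: avg_cauchy_schwarz.
  by rewrite -deE.
rewrite {1 2}/avg !tensD -!/(avg _ _) addrA lerD2r.
have ind1 (F : R -> R) : indep i (fun y => F (al y)).
  by move=> y z yz; rewrite (ali y z yz).
rewrite (avg1_indep mu_prob b2i) (avg1_indep mu_prob (ind1 (fun t => powR t p))).
rewrite (avg1_pull _ _ _ (ind1 (fun t => p * powR t (p - 1)))) //.
rewrite {1}/avg tensD tensZ -!/(avg _ _) be0 mulr0 add0r.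
have g0 : 0 <= avg mu [set i] ga x by apply: avg_ge0.
apply: le_trans (powR_tangentD p1 (al0 x) g0) _.
by apply: ge0_ler_powR => //; rewrite ?nnegrE ?addr_ge0 // (le_trans _ (b2E x)) ?addr_ge0.
Qed.

(* The coordinates outside [U] and [V] are those kept in the outer norm: the hypothesis leaves them
   fixed, which is what makes it pass to both functions produced by [mixed_moment_step]. *)
Lemma noise_on_mixed_moment_le (p r rho M : R) : 1 <= p -> 1 <= r -> 0 <= rho ->
  2 * r * rho <= ln (2 * p) / (32 * p) -> 0 <= M ->
  forall U V h,
  (forall T, T \subset U -> forall x,
     avg mu (V :|: (U :\: T)) (fun y => h y ^+ 2) x <= (r ^+ 2) ^+ #|T| * M) ->
  mixed_moment p V (noise_on mu rho U h) <= powR M (p - 1) * mean mu (fun x => h x ^+ 2).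
Proof.
move=> p1 r1 rho0 erho M0 U.
have [k] := ubnP #|U|; elim: k U => // k IH U Uk V h glob.
have [U0|[i iU]] := set_0Vmem U.
  subst U; rewrite noise_on_set0 // /mixed_moment -meanZ -(mean_avg mu_prob V).
  rewrite -[leRHS](mean_avg mu_prob V).
  rewrite [leLHS](mean_avg mu_prob V); apply: ler_mean => // x.
  rewrite {2}/avg tensZ -/(avg _ _).
  (* For empty [T] globalness says [A <= M], so [A^p = A^(p-1) A <= M^(p-1) A]. *)
  have := glob set0 (sub0set _) x; rewrite setD0 setU0 cards0 expr0 mul1r.
  have : 0 <= avg mu V (fun y => h y ^+ 2) x by apply: avg_ge0 => // y; exact: sqr_ge0.
  set A := avg _ _ _ _ => A0 AM.
  rewrite -(@mulr_powRB1 _ A p) //; last lra.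
  rewrite mulrC ler_wpM2r //; apply: ge0_ler_powR; rewrite ?nnegrE //; lra.
have r0 : 0 < r by lra.
set U' := U :\ i.
have UE : U = i |: U' by rewrite setD1K.
have iU' : i \notin U' by rewrite !inE eqxx.
have U'k : (#|U'| < k)%N by move: Uk; rewrite (cardsD1 i) iU.
pose a := avg mu [set i] h.
pose hB := fun x => a x + 1 / 2 * (h x - a x).
pose hC := fun x => (2 * r)^-1 * (h x - a x).
pose c := (2 * r)^-1.
have c0 : 0 <= c by rewrite invr_ge0; lra.
have c2 : c <= 1 / 2 by rewrite -[c]mul1r ler_pdivrMr; lra.
have cr : c ^+ 2 * (4 * r ^+ 2) = 1 by rewrite /c; field; lra.
have noise_lin s t x : noise_on mu rho U' (fun y => s * h y + t * a y) x =
    s * noise_on mu rho U' h x + t * avg mu [set i] (noise_on mu rho U' h) x.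
  by rewrite {1}/noise_on tensD !tensZ -!/(noise_on _ _ _) noise_on_avg1.
set g := noise_on mu rho U' h.
(* The step is applied with [e = 2 r rho] and [c = 1 / (2 r)], so that [e c = rho] is exactly the
   noise on coordinate [i]. *)
have -> : noise_on mu rho U h =
    (fun x => avg mu [set i] g x + 2 * r * rho * c * (g x - avg mu [set i] g x)).
  apply/funext => x; rewrite UE noise_on_setU1 // -/g.
  have -> : 2 * r * rho * c = rho by rewrite /c; field; lra.
  ring.
have step : _ <= _ := @mixed_moment_step p (2 * r * rho) c V i g p1 _ erho c0 c2.
apply: le_trans (step _) _; first by rewrite !mulr_ge0 //; lra.
(* Noise on [U'] commutes with [E_i], so both functions from the step are noise images of [hB] and
   [hC], to which the induction hypothesis applies. *)
have -> : (fun x => avg mu [set i] g x + 1 / 2 * (g x - avg mu [set i] g x)) =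
    noise_on mu rho U' hB.
  apply/funext => x.
  have -> : hB = (fun y => 1 / 2 * h y + 1 / 2 * a y) by apply/funext => y; rewrite /hB; field.
  by rewrite noise_lin // -/g; field.
have -> : (fun x => c * (g x - avg mu [set i] g x)) = noise_on mu rho U' hC.
  apply/funext => x.
  have -> : hC = (fun y => c * h y + (- c) * a y) by apply/funext => y; rewrite /hC /c; ring.
  by rewrite noise_lin // -/g; ring.
have setU_D T : T \subset U' -> U :\: T = i |: (U' :\: T).
  move=> TU; rewrite UE setDUl; congr (_ :|: _); apply/setDidPl.
  by rewrite disjoints1; apply: contra iU'; apply: (fintype.subsetP TU).
(* Coordinate [i] is averaged here, and [E_i hB^2 <= E_i h^2], so the globalness of [h] carries
   over. *)
have globB : mixed_moment p (i |: V) (noise_on mu rho U' hB) <=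
    powR M (p - 1) * mean mu (fun x => hB x ^+ 2).
  apply: IH => // T TU x.
  have TU' : T \subset U by apply: (fintype.subset_trans TU); rewrite subD1set.
  apply: le_trans (glob T TU' x).
  rewrite (setU_D T TU) -setUA (setUCA V) (setUC [set i]) -!(avg_comp mu_prob _ [set i]).
  apply: ler_avg => // y; rewrite avg1_sqr_dev //.
  have := avg1_sqr_le mu_prob i h y; lra.
have globC : mixed_moment p V (noise_on mu rho U' hC) <=
    powR M (p - 1) * mean mu (fun x => hC x ^+ 2).
  apply: IH => // T TU x.
  have TU' : T \subset U by apply: (fintype.subset_trans TU); rewrite subD1set.
  have iT : i \notin T by apply: contra iU'; apply: (fintype.subsetP TU).
  have iTU : i |: T \subset U by rewrite subUset sub1set iU.
  set W := V :|: (U' :\: T).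
  have K0 : 0 <= (r ^+ 2) ^+ #|T| * M by rewrite mulr_ge0 // !exprn_ge0 // ltW.
  set K := _ * M in K0 *.
  (* Here [i] stays fixed: [h] is controlled by globalness for [i |: T], at the price of a factor
     [r^2], and [a^2 <= E_i h^2] by globalness for [T]. The choice of [c] makes [4 c^2 r^2 = 1]. *)
  have H1 : avg mu W (fun y => h y ^+ 2) x <= r ^+ 2 * K.
    have := glob (i |: T) iTU x; rewrite cardsU1 iT add1n (exprS (r ^+ 2)) -mulrA.
    by have -> : U :\: (i |: T) = U' :\: T by rewrite /U' setDDl.
  have H2 : avg mu W (avg mu [set i] (fun y => h y ^+ 2)) x <= r ^+ 2 * K.
    have r2 : 1 <= r ^+ 2 by rewrite expr_ge1 // ltW.
    have := glob T TU' x; rewrite (setU_D T TU) setUCA setUC -(avg_comp mu_prob) => H.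
    by apply: (le_trans H); rewrite ler_peMl.
  have : avg mu W (fun y => hC y ^+ 2) x <= avg mu W (fun y =>
      2 * c ^+ 2 * h y ^+ 2 + 2 * c ^+ 2 * avg mu [set i] (fun z => h z ^+ 2) y) x.
    apply: ler_avg => // y; have := avg1_sqr_le mu_prob i h y; rewrite -/a => aa.
    have : (h y - a y) ^+ 2 <= 2 * h y ^+ 2 + 2 * a y ^+ 2.
      by have := sqr_ge0 (h y + a y); lra.
    rewrite /hC -/c exprMn => hh.
    have := ler_wpM2l (sqr_ge0 c) hh; have := ler_wpM2l (sqr_ge0 c) aa; lra.
  rewrite {2}/avg tensD !tensZ -!/(avg _ _) => H3; apply: (le_trans H3).
  have cc := sqr_ge0 c.
  have := ler_wpM2l cc H1; have := ler_wpM2l cc H2.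
  have : K = c ^+ 2 * (4 * r ^+ 2) * K by rewrite cr mul1r.
  lra.
apply: le_trans (lerD globB globC) _.
(* After averaging over [i], the two squares sum to [a^2] plus [1/4 + c^2 <= 1/2] times the
   variance, which is at most [E_i h^2]. *)
rewrite -mulrDr ler_wpM2l ?powR_ge0 // -meanD -(mean_avg mu_prob [set i]).
rewrite -[leRHS](mean_avg mu_prob [set i]); apply: ler_mean => // x.
rewrite {1}/avg tensD -!/(avg _ _) avg1_sqr_dev // avg1_dev_sqr // -/c.
have := avg1_sqr_le mu_prob i h x.
have : c ^+ 2 <= 1 / 4 by rewrite expr2; nra.
nra.
Qed.

End GlobalHypercontractivity.

(** * Translation to the norms of the statement *)

Lemma sqr_restr_lpnorm (R : realType) (Omega : finType) (mu : Omega -> R) (n : nat)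
    (S : {set 'I_n}) (x : pt Omega n) (f : pt Omega n -> R) : (forall w, 0 <= mu w) ->
  restr_lpnorm mu 2 S x f ^+ 2 = avg mu (~: S) (fun y => f y ^+ 2) x.
Proof.
move=> mu0; set s := avg _ _ _ _.
have -> : restr_lpnorm mu 2 S x f = powR s 2^-1.
  congr (powR _ _); rewrite big_mkcond; apply: eq_bigr => y _ /=.
  rewrite powR_mulrn // -normrX ger0_norm ?sqr_ge0 //.
  (* On [S] the kernel is a delta; the product of these deltas is the indicator of the points
     agreeing with [x] on [S]. *)
  have -> : \prod_(i < n) avg_kernel mu (~: S) i (x i) (y i) =
      (\prod_(i in ~: S) mu (y i)) * \prod_(i in S) (x i == y i)%:R.
    rewrite (bigID (mem (~: S))) /=; congr (_ * _).
      by apply: eq_bigr => i iS; rewrite /avg_kernel iS.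
    apply: eq_big => [i|i /negPf iS]; first by rewrite inE negbK.
    by rewrite /avg_kernel iS.
  have [/forallP H|] := ifPn.
    rewrite [X in _ = _ * X * _]big1 ?mulr1 // => i iS.
    by move: (H i); rewrite iS /= => /eqP ->; rewrite eqxx.
  rewrite negb_forall => /existsP[i]; rewrite negb_imply => /andP[iS yx].
  by rewrite [X in _ = _ * X * _](bigD1 i) //= eq_sym (negPf yx) mul0r mulr0 mul0r.
rewrite -powR_mulrn ?powR_ge0 // -powRrM mulVf ?pnatr_eq0 // powRr1 //.
apply: sumr_ge0 => y _; rewrite mulr_ge0 ?sqr_ge0 // prodr_ge0 // => i _.
by rewrite /avg_kernel; case: ifP => // _; rewrite ler0n.
Qed.

Theorem mainTheorem1 (R : realType) (Omega : finType) (mu : Omega -> R)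
  (n : nat) (q r rho : R) (f : pt Omega n -> R) :
  is_prob_space mu ->
  2 <= q -> 1 <= r ->
  (forall (S : {set 'I_n}) (x : pt Omega n),
      restr_lpnorm mu 2 S x f <= r ^+ #|S| * lpnorm mu 2 f) ->
  0 < rho -> rho <= ln q / (32 * r * q) ->
  lpnorm mu q (T_rho mu rho f) <= lpnorm mu 2 f.
Proof.
move=> mu_prob q2 r1 glob rho0 rhoq.
have mu0 := proj1 mu_prob.
pose M := mean mu (fun x => f x ^+ 2).
have M0 : 0 <= M by apply: sumr_ge0 => x _; rewrite mulr_ge0 ?sqr_ge0 ?prodr_ge0.
have normf : lpnorm mu 2 f = powR M 2^-1.
  congr (powR _ _); apply: eq_bigr => x _.
  by rewrite powR_mulrn // -normrX ger0_norm ?sqr_ge0.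
have normf2 : lpnorm mu 2 f ^+ 2 = M.
  by rewrite normf -powR_mulrn ?powR_ge0 // -powRrM mulVf ?pnatr_eq0 // powRr1.
have q0 : 0 < q by lra.
pose p := q / 2.
have p1 : 1 <= p by rewrite /p; lra.
have qE : 2 * p = q by rewrite /p; field.
(* The constant 32 is used up exactly: both bounds equal [ln q / (16 q)]. *)
have erho : 2 * r * rho <= ln (2 * p) / (32 * p).
  rewrite qE; have := ler_wpM2l (ltW (_ : 0 < 2 * r)) rhoq => H.
  have {}H : 2 * r * rho <= 2 * r * (ln q / (32 * r * q)) by apply: H; lra.
  apply: (le_trans H); rewrite /p le_eqVlt; apply/orP; left; apply/eqP; field; lra.
have := @noise_on_mixed_moment_le R Omega n mu mu_prob p r rho M p1 r1 (ltW rho0) erho M0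
  setT set0 f => main.
have {}main : mixed_moment mu p set0 (noise_on mu rho setT f) <= powR M (p - 1) * M.
  (* Starting from all coordinates, the averaged set is the complement of [T], and the requirement
     is the squared globalness hypothesis for [S = T]. *)
  apply: main => T _ x; rewrite set0U setTD -sqr_restr_lpnorm // -normf2 -exprM mulnC exprM -exprMn.
  by rewrite ler_pXn2r ?nnegrE ?mulr_ge0 ?powR_ge0 ?exprn_ge0 //; lra.
rewrite normf /lpnorm.
have -> : \sum_x mu_n mu x * powR `|T_rho mu rho f x| q =
    mixed_moment mu p set0 (noise_on mu rho setT f).
  apply: eq_bigr => x _; rewrite avg0 // noise_on_setT.
  by rewrite -real_normK ?num_real // -powR_mulrn // -powRrM qE.
rewrite mulrC mulr_powRB1 // in main; last lra.
have -> : powR M 2^-1 = powR (powR M p) q^-1.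
  by rewrite -powRrM; congr (powR _ _); rewrite /p; field; lra.
apply: ge0_ler_powR => //; rewrite ?nnegrE ?powR_ge0 ?invr_ge0 ?(ltW q0) //.
by rewrite /mixed_moment /mean; apply: sumr_ge0 => x _; rewrite mulr_ge0 ?powR_ge0 ?prodr_ge0.
Qed.
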